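(* Let $n\geq2$ be an integer and let $\|x\|=\sqrt{x_1^2+\ldots+x_n^2}$ be the Euclidean norm on $\mathbb{R}^n$. Then for all $f\in C_0^1(\mathbb{R}^n)$, $$\int_{\mathbb{R}^{n}}\frac{|f(x)|^{n}}{\|x\|^{n}}dx\leq\int_{\mathbb{R}^{n}}\left|\nabla f(x)\right|^{n}dx+(n-1)\int_{\mathbb{R}^{n}}\frac{\left|\log\frac{1}{\|x\|}\right|^{\frac{n}{n-1}}}{\|x\|^{n}}|f(x)|^{n}dx,$$ where $\nabla$ is the standard gradient on $\mathbb{R}^n$.
   Context: $C_0^1(\mathbb{R}^n)$ denotes compactly supported $C^1$ functions on $\mathbb{R}^n$. *)

(* Defs.v *)
From HB Require Import structures.
From mathcomp Require Import all_boot all_order all_algebra.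
From mathcomp Require Import all_classical all_reals all_analysis.

Set Implicit Arguments.
Unset Strict Implicit.
Unset Printing Implicit Defensive.

Import Order.TTheory GRing.Theory Num.Theory.
Import numFieldNormedType.Exports.

Local Open Scope classical_set_scope.
Local Open Scope ring_scope.

(* ['rV[T]_n] carries the product sigma-algebra, i.e. the one generated by the
   coordinate projections, as the library does for [n.-tuple T]; over a
   [realType] this is the Borel sigma-algebra of R^n. *)
Definition measure_rV_display : measure_display -> measure_display.
Proof. exact. Qed.

Section measurable_rV.
Context {d} {T : sigmaRingType d}.
Variable n : nat.

Let coors : 'I_n -> 'rV[T]_n -> T := fun i v => v ord0 i.

Let rV_set0 : g_sigma_preimage coors set0.
Proof. exact: sigma_algebra0. Qed.

Let rV_setC A : g_sigma_preimage coors A -> g_sigma_preimage coors (~` A).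
Proof. exact: sigma_algebraC. Qed.

Let rV_bigcup (F : _^nat) : (forall i, g_sigma_preimage coors (F i)) ->
  g_sigma_preimage coors (\bigcup_i (F i)).
Proof. exact: sigma_algebra_bigcup. Qed.

HB.instance Definition _ := @isMeasurable.Build (measure_rV_display d)
  'rV[T]_n (g_sigma_preimage coors) rV_set0 rV_setC rV_bigcup.

End measurable_rV.

Lemma measurable_coord d (T : sigmaRingType d) n (i : 'I_n) :
  measurable_fun [set: 'rV[T]_n] (fun v => v ord0 i).
Proof.
move=> _ Y mY; rewrite setTI; apply: sub_sigma_algebra => /=.
rewrite -bigcup_seq/=; exists i => /=; first by rewrite mem_index_enum.
by exists Y => //; rewrite setTI.
Qed.

Lemma measurable_fun_rVP d1 d2 (T1 : measurableType d1) (T2 : measurableType d2)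
    n (f : T1 -> 'rV[T2]_n) :
  measurable_fun [set: T1] f <->
  forall i, measurable_fun [set: T1] (fun x => f x ord0 i).
Proof.
split=> [mf i|mf].
  exact: (measurableT_comp (@measurable_coord _ T2 n i) mf).
move=> _ A; rewrite setTI => mA.
have : (image_set_system [set: T1] f measurable) A.
  move: A mA; apply: smallest_sub.
    exact/sigma_algebra_image/sigma_algebra_measurable.
  move=> A; rewrite -bigcup_seq => -[i _ [B mB <-]].
  rewrite /image_set_system /= !setTI.
  by have := mf i measurableT B mB; rewrite setTI.
by rewrite /image_set_system/= setTI.
Qed.

Section lebesgue_measure_rV.
Context (R : realType).
Local Open Scope ereal_scope.

Definition rV_cons n (p : 'rV[R]_n * R) : 'rV[R]_n.+1 :=
  row_mx (const_mx p.2 : 'rV_1) p.1.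

Lemma rV_consl n (p : 'rV[R]_n * R) (j : 'I_1) :
  rV_cons p ord0 (lshift n j) = p.2.
Proof. by rewrite /rV_cons; etransitivity; [exact: row_mxEl|rewrite mxE]. Qed.

Lemma rV_consr n (p : 'rV[R]_n * R) (j : 'I_n) :
  rV_cons p ord0 (rshift 1 j) = p.1 ord0 j.
Proof. exact: row_mxEr. Qed.

Lemma measurable_rV_cons n : measurable_fun setT (@rV_cons n).
Proof.
apply/measurable_fun_rVP => i.
case: (@splitP 1 n i) => j ij.
- rewrite (_ : (fun _ => _) = snd); first exact: measurable_snd.
  apply/funext => p; rewrite (_ : i = lshift n j); last exact/val_inj.
  by rewrite rV_consl.
- rewrite (_ : (fun _ => _) = (fun v : 'rV[R]_n => v ord0 j) \o fst).
    by apply: measurableT_comp; [exact: measurable_coord|exact: measurable_fst].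
  apply/funext => p; rewrite (_ : i = rshift 1 j); last exact/val_inj.
  by rewrite rV_consr.
Qed.

Section lebesgue_measure_rV_succ.
Variables (n : nat) (mu : {measure set 'rV[R]_n -> \bar R}).

Definition lebesgue_measure_rV_succ : set 'rV[R]_n.+1 -> \bar R :=
  pushforward (mu \x @lebesgue_measure R) (@rV_cons n).

Let mrV_cons := @measurable_rV_cons n.

Let succ0 : lebesgue_measure_rV_succ set0 = 0.
Proof. exact: measure0. Qed.

Let succ_ge0 A : 0 <= lebesgue_measure_rV_succ A.
Proof. exact: measure_ge0. Qed.

Let succ_sigma_additive : semi_sigma_additive lebesgue_measure_rV_succ.
Proof. exact: measure_semi_sigma_additive. Qed.

HB.instance Definition _ := isMeasure.Build _ _ _ lebesgue_measure_rV_succ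
  succ0 succ_ge0 succ_sigma_additive.

End lebesgue_measure_rV_succ.

(* The n-fold product of the one-dimensional Lebesgue measure. Putting the new
   factor on the right of [\x] spares the recursion a sigma-finiteness proof. *)
Fixpoint lebesgue_measure_rV n : {measure set 'rV[R]_n -> \bar R} :=
  match n with
  | 0 => dirac (0%R : 'rV[R]_0)
  | m.+1 => lebesgue_measure_rV_succ (lebesgue_measure_rV m)
  end.

Lemma lebesgue_measure_rV_box n (A : 'I_n -> set R) :
  (forall i, measurable (A i)) ->
  lebesgue_measure_rV n [set v : 'rV[R]_n | forall i, A i (v ord0 i)] =
  \prod_(i < n) lebesgue_measure (A i).
Proof.
elim: n A => [|n IH] A mA.
  by rewrite big_ord0 /= diracE mem_set// => -[].
transitivity ((lebesgue_measure_rV n \x @lebesgue_measure R)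
    ([set v : 'rV[R]_n | forall i, A (rshift 1 i) (v ord0 i)] `*` A (lshift n (@ord0 0)))).
  rewrite /= /lebesgue_measure_rV_succ /pushforward; congr (_ _).
  apply/seteqP; split => -[v x] /=.
    move=> vA; split => [i|].
      by have := vA (rshift 1 i); rewrite rV_consr.
    by have := vA (lshift n (@ord0 0)); rewrite rV_consl.
  move=> [vA xA] i; case: (@splitP 1 n i) => j ij.
    rewrite (_ : i = lshift n j); last exact/val_inj.
    by rewrite rV_consl (ord1 j).
  rewrite (_ : i = rshift 1 j); last exact/val_inj.
  by rewrite rV_consr.
rewrite product_measure1E//; last exact: mA.
  by rewrite (@big_split_ord _ _ _ 1 n) big_ord1 muleC; congr (_ * _); exact: IH.
suff -> : [set v : 'rV[R]_n | forall i, A (rshift 1 i) (v ord0 i)] =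
    \bigcap_(i in setT)
      ((fun v : 'rV[R]_n => v ord0 i) @^-1` A (rshift 1 i)).
  apply: fin_bigcap_measurable => // i _.
  by rewrite -[X in measurable X]setTI; apply: measurable_coord.
by apply/seteqP; split => v /= vA i; [move=> _; exact: vA|exact: vA].
Qed.

End lebesgue_measure_rV.

Section euclidean.
Context (R : realType) (n : nat).
Implicit Types (x : 'rV[R]_n) (f : 'rV[R]_n -> R).

(* The norm of the library on ['rV[R]_n], written [`|x|], is the sup norm; it
   induces the same topology and the same differentiable functions. *)
Definition enorm x : R := Num.sqrt (\sum_(i < n) x ord0 i ^+ 2).

(* [delta_mx ord0 i] is the i-th vector of the standard basis. *)
Definition gradient f x : 'rV[R]_n := \row_i 'D_(delta_mx ord0 i) f x.

Definition compactly_supported f := compact (closure [set x | f x != 0]).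

Definition C1 f := (forall x, differentiable f x) /\ continuous (gradient f).

(* Real-valued compactly supported functions of class C^1. *)
Definition C01 f := C1 f /\ compactly_supported f.

End euclidean.

(* Main.v *)
From HB Require Import structures.
Require Import Defs.
From mathcomp Require Import all_boot all_order all_algebra.
From mathcomp Require Import all_classical all_reals all_analysis.
From mathcomp Require Import measurable_realfun.
From mathcomp Require Import ring lra.

Set Implicit Arguments.
Unset Strict Implicit.
Unset Printing Implicit Defensive.

Import Order.TTheory GRing.Theory Num.Theory.
Import numFieldNormedType.Exports.

Local Open Scope classical_set_scope.
Local Open Scope ring_scope.

(** The vector field F(x) = |f|^n log|x| x / |x|^n, with x / |x|^n divergence
    free away from the origin, has divergence
      |f|^n / |x|^n + n |f|^(n-2) f log|x| (x . grad f) / |x|^n.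
    Its integral vanishes, so Young's inequality with exponents n and n / (n-1)
    gives the claim.  If either integral on the right is infinite there is
    nothing to prove.  Otherwise each d_i F_i is integrable: near the origin
    |log|x||^(n/(n-1)) >= 1, so the weighted integral controls the singular
    terms even when f(0) <> 0.  As n >= 2, almost every line parallel to an axis
    avoids the origin, and on such a line d_i F_i is the derivative of a
    compactly supported C^1 function; hence its integral is zero by Tonelli. *)

(** * Measurability of open sets, continuous functions and powers of the Euclidean norm *)

Section measurability.
Context (R : realType) (n : nat).

(** The sigma-algebra is generated by the coordinates, so the topology has to be reached through
    boxes: [U] is the union of those cubes with rational centre and radius [1 / (k + 1)] that lie
    inside it, and there are countably many. *)
Lemma open_measurable_rV (U : set 'rV[R]_n) : open U -> measurable U.
Proof.
move=> oU.
pose B (qk : 'rV[rat]_n * nat) : set 'rV[R]_n :=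
  [set y | forall i, `|ratr (qk.1 ord0 i) - y ord0 i| < qk.2.+1%:R^-1].
have mB qk : measurable (B qk).
  rewrite (_ : B qk = \bigcap_(i in [set: 'I_n])
      ((fun v : 'rV[R]_n => v ord0 i) @^-1` ball (ratr (qk.1 ord0 i) : R) qk.2.+1%:R^-1)).
    apply: fin_bigcap_measurable => // i _.
    rewrite -[X in measurable X]setTI; apply: measurable_coord => //.
    exact: measurable_ball.
  by apply/seteqP; split => y /= By i; [move=> _; exact: By|exact: By].
rewrite (_ : U = \bigcup_qk (if `[< B qk `<=` U >] then B qk else set0)).
  by apply: countable_bigcupT_measurable => // qk; case: ifP.
apply/seteqP; split => [x Ux|x [qk _]]; last first.
  by case: ifPn => // /asboolP; exact.
have /nbhs_ballP[e /= e0 eU] := open_nbhs_nbhs (conj oU Ux).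
(* A cube of radius below [e / 2] that contains [x] lies in the ball of radius [e] about [x], by the
   triangle inequality through its centre. *)
have e20 : 0 < e / 2 by rewrite divr_gt0.
pose k := Num.truncn (e / 2)^-1.
have ke : (k.+1%:R^-1 : R) < e / 2.
  by rewrite invf_plt ?posrE//; apply: truncnS_gt.
have k0 : 0 < (k.+1%:R^-1 : R) by rewrite invr_gt0.
have qx i : exists q : rat, `|ratr q - x ord0 i| < k.+1%:R^-1.
  have xk : x ord0 i < x ord0 i + k.+1%:R^-1 by rewrite ltrDl.
  have [q] := rat_in_itvoo xk.
  rewrite in_itv/= => /andP[q1 q2]; exists q.
  by rewrite gtr0_norm ?subr_gt0// ltrBlDl.
have /choice[q qP] := qx.
exists (\row_i q i, k) => //.
have Bx : B (\row_i q i, k) x by move=> i /=; rewrite mxE.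
case: asboolP => // nBU; exfalso; apply: nBU => y By; apply: eU; split => //.
move=> i j; rewrite (ord1 i) /ball/=.
rewrite (le_lt_trans (ler_distD (ratr (q j)) _ _))// [e]splitr ltrD//.
  by rewrite distrC (lt_trans (qP j)).
by have := By j; rewrite mxE => /lt_trans; exact.
Qed.

Lemma continuous_measurable_rV (f : 'rV[R]_n -> R) :
  continuous f -> measurable_fun setT f.
Proof.
move=> /continuousP cf; apply: (measurability _ (RGenOpens.measurableE R)).
move=> _ [_ [a [b -> <-]]]; rewrite setTI; apply: open_measurable_rV.
by apply: cf; exact: interval_open.
Qed.

Lemma measurable_enorm : measurable_fun setT (@enorm R n).
Proof.
apply: measurableT_comp.
  by apply: continuous_measurable_fun; exact: sqrt_continuous.
apply: measurable_sum => i; apply: measurable_funX; exact: measurable_coord.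
Qed.

Lemma measurable_enormXV k :
  measurable_fun setT (fun x : 'rV[R]_n => (enorm x ^+ k)^-1).
Proof.
(* The real power with exponent [-1] is measurable on the whole line and agrees with the inverse on
   nonnegative numbers, even at [0], where both are [0]. *)
rewrite (_ : (fun _ => _) = (fun x : 'rV[R]_n => (enorm x ^+ k) `^ (-1))).
  apply: (measurableT_comp (measurable_powR _)); apply: measurable_funX.
  exact: measurable_enorm.
by apply/funext => x; rewrite powR_inv1// exprn_ge0// sqrtr_ge0.
Qed.

End measurability.

(** * Sigma-finiteness and Tonelli along lines parallel to an axis *)

Section lines.
Context (R : realType).
Local Open Scope ereal_scope.

Lemma measurable_box n (A : 'I_n -> set R) : (forall i, measurable (A i)) ->
  measurable [set v : 'rV[R]_n | forall i, A i (v ord0 i)].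
Proof.
move=> mA.
rewrite (_ : mkset _ = \bigcap_(i in [set: 'I_n])
    ((fun v : 'rV[R]_n => v ord0 i) @^-1` A i)).
  apply: fin_bigcap_measurable => // i _.
  by rewrite -[X in measurable X]setTI; apply: measurable_coord.
by apply/seteqP; split => y /= By i; [move=> _; exact: By|exact: By].
Qed.

Lemma lebesgue_measure_rV_cube_lty n (M : R) :
  lebesgue_measure_rV R n [set v | forall i, v ord0 i \in `[(- M)%R, M]] < +oo.
Proof.
rewrite (@lebesgue_measure_rV_box R n (fun=> `[(- M)%R, M]%classic))//.
suff [] : (0 <= \prod_(i < n) @lebesgue_measure R `[(- M)%R, M] /\
    \prod_(i < n) @lebesgue_measure R `[(- M)%R, M] < +oo) by [].
elim/big_ind : _ => [|a b [a0 aoo] [b0 boo]|i _].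
- by rewrite lee_fin ler01 ltry.
- by rewrite mule_ge0// lte_mul_pinfty// ge0_fin_numE.
- split; first exact: measure_ge0.
  by rewrite lebesgue_measure_itv/=; case: ifP; rewrite ?ltry// -EFinB ltry.
Qed.

Lemma lebesgue_measure_rV_sigma_finite n :
  sigma_finite setT (lebesgue_measure_rV R n).
Proof.
exists (fun k => [set v : 'rV[R]_n | forall i, v ord0 i \in `[(- k%:R)%R, k%:R%R]]).
  apply/seteqP; split => // v _.
  have [k vk] : exists k, forall i, (`|v ord0 i| <= k%:R)%R.
    exists (\max_i (Num.truncn `|v ord0 i|).+1)%N => i.
    rewrite (le_trans (ltW (truncnS_gt _)))// ler_nat.
    exact: (leq_bigmax i).
  by exists k => //= i; rewrite in_itv/= -ler_norml; exact: vk.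
move=> k; split; last exact: lebesgue_measure_rV_cube_lty.
exact: (@measurable_box n (fun=> `[(- k%:R)%R, k%:R%R]%classic)).
Qed.

Definition upd n (x : 'rV[R]_n) (i : 'I_n) (t : R) : 'rV[R]_n :=
  \row_j if j == i then t else x ord0 j.

(* Stated for nonnegative functions, to be applied to the positive and negative
   parts of a signed one: Tonelli then needs no integrability on the lines. *)
Lemma eq_integral_lines n (i : 'I_n) (g1 g2 : 'rV[R]_n -> \bar R) :
  measurable_fun setT g1 -> measurable_fun setT g2 ->
  (forall x, 0 <= g1 x) -> (forall x, 0 <= g2 x) ->
  (forall x, \int[lebesgue_measure]_t g1 (upd x i t) =
             \int[lebesgue_measure]_t g2 (upd x i t)) ->
  \int[lebesgue_measure_rV R n]_x g1 x = \int[lebesgue_measure_rV R n]_x g2 x.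
Proof.
elim: n i g1 g2 => [[]//|n IH i g1 g2 mg1 mg2 g10 g20 g12].
(* The recursively defined measure is only declared as a measure; Tonelli needs the sigma-finite
   structure packed onto it. *)
pose m : {sigma_finite_measure set 'rV[R]_n -> \bar R} :=
  HB.pack (Measure.sort (lebesgue_measure_rV R n))
    (isSFinite.Build _ _ _ _
      (sfinite_measure_sigma_finite (lebesgue_measure_rV_sigma_finite n)))
    (isSigmaFinite.Build _ _ _ _ (lebesgue_measure_rV_sigma_finite n)).
have pushE (g : 'rV[R]_n.+1 -> \bar R) : measurable_fun setT g ->
    (forall x, 0 <= g x) ->
    \int[lebesgue_measure_rV R n.+1]_x g x =
    \int[m \x @lebesgue_measure R]_p g (rV_cons p).
  move=> mg g0.
  transitivity (\int[pushforward (m \x @lebesgue_measure R) (@rV_cons R n)]_x g x).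
    by apply: eq_measure_integral => [|A mA _]; first exact: measurable_rV_cons.
  by rewrite ge0_integral_pushforward//; exact: measurable_rV_cons.
have mc (g : 'rV[R]_n.+1 -> \bar R) : measurable_fun setT g ->
    measurable_fun setT (g \o @rV_cons R n).
  by move=> mg; exact: measurableT_comp mg (@measurable_rV_cons R n).
have F1 (g : 'rV[R]_n.+1 -> \bar R) : measurable_fun setT g ->
    (forall x, 0 <= g x) -> \int[m \x @lebesgue_measure R]_p g (rV_cons p) =
    \int[m]_v \int[@lebesgue_measure R]_t g (rV_cons (v, t)).
  move=> mg g0; exact: (@fubini_tonelli1 _ _ _ _ R m (@lebesgue_measure R)
    (g \o @rV_cons R n) (mc _ mg) (fun=> g0 _)).
have F2 (g : 'rV[R]_n.+1 -> \bar R) : measurable_fun setT g ->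
    (forall x, 0 <= g x) -> \int[m \x @lebesgue_measure R]_p g (rV_cons p) =
    \int[@lebesgue_measure R]_t \int[m]_v g (rV_cons (v, t)).
  move=> mg g0; exact: (@fubini_tonelli2 _ _ _ _ R m (@lebesgue_measure R)
    (g \o @rV_cons R n) (mc _ mg) (fun=> g0 _)).
rewrite !pushE//.
(* [rV_cons] puts the factor [R] in first position. If [i] is that coordinate, the inner integral of
   Tonelli is the line integral; otherwise that coordinate is integrated last and induction applies
   to each slice at fixed [t]. *)
case: (@splitP 1 n i) => j ij.
- have {}ij : i = lshift n j by exact/val_inj.
  rewrite !F1//.
  apply: eq_integral => v _.
  have consE t : rV_cons (v, t) = upd (rV_cons (v, 0%R)) i t.
    apply/rowP => k; rewrite [RHS]mxE ij; case: (@splitP 1 n k) => l kl.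
      have -> : k = lshift n l by exact/val_inj.
      by rewrite (ord1 l) (ord1 j) eqxx rV_consl.
    have -> : k = rshift 1 l by exact/val_inj.
    by case: eqP => [/(congr1 val)|_]; rewrite ?(ord1 j)// !rV_consr.
  by under eq_integral do rewrite consE; under [RHS]eq_integral do rewrite consE.
- have {}ij : i = rshift 1 j by exact/val_inj.
  rewrite !F2//.
  apply: eq_integral => t _.
  have mt (g : 'rV[R]_n.+1 -> \bar R) : measurable_fun setT g ->
      measurable_fun setT (fun v => g (rV_cons (v, t))).
    move=> mg; apply: (measurableT_comp (mc _ mg)).
    exact: measurable_pair2.
  apply: (IH j) => // [||v]; [exact: mt|exact: mt|].
  have consE s : rV_cons (upd v j s, t) = upd (rV_cons (v, t)) i s.
    apply/rowP => k; rewrite [RHS]mxE ij; case: (@splitP 1 n k) => l kl.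
      have -> : k = lshift n l by exact/val_inj.
      by case: eqP => [/(congr1 val)|_]; rewrite ?(ord1 l)// !rV_consl.
    have -> : k = rshift 1 l by exact/val_inj.
    by rewrite !rV_consr mxE; rewrite (inj_eq (@rshift_inj 1 n)).
  by under eq_integral do rewrite consE; under [RHS]eq_integral do rewrite consE.
Qed.

End lines.

(** * One-variable calculus on a line that misses the origin *)

Section one_variable.
Context (R : realType).

Lemma is_derive_outside0 (phi : R -> R) (dphi M t : R) :
  is_derive t 1 phi dphi -> (forall s, M <= `|s| -> phi s = 0) ->
  M < `|t| -> dphi = 0.
Proof.
move=> dt phi0 Mt.
have d0 : is_derive t 1 phi 0.
  apply: (near_eq_is_derive _ (is_derive_cst (0 : R) t 1)).
  have : \forall s \near t, M < `|s|.
    exact: (cvgr_gt `|t| (@norm_continuous _ _ t)).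
  by apply: filterS => s /ltW/phi0 ->.
by case: dt d0 => _ <- [_ <-].
Qed.

(** The fundamental theorem of calculus on [[-M, M]] gives [phi M - phi (- M) = 0]. Equating
    positive and negative parts is the form that [eq_integral_lines] accepts. *)
Lemma integral_derive_compact (phi dphi : R -> R) (M : R) : 0 < M ->
  (forall t : R, is_derive t 1 phi (dphi t)) -> continuous dphi ->
  (forall s, M <= `|s| -> phi s = 0) ->
  (\int[lebesgue_measure]_t ((EFin \o dphi)^\+ t) =
   \int[lebesgue_measure]_t ((EFin \o dphi)^\- t))%E.
Proof.
move=> M0 dP cd phi0.
have NM : - M < M by rewrite gtrN.
have out0 t : t \notin `[(- M)%R, M]%classic -> dphi t = 0.
  move=> tM; apply: (is_derive_outside0 (dP t) phi0).
  rewrite ltNge; apply: contra tM.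
  by rewrite ler_norml inE/= in_itv.
have cphi : continuous phi.
  by move=> t; apply/differentiable_continuous/derivable1_diffP; case: (dP t).
have int0 : (\int[lebesgue_measure]_(t in `[(- M)%R, M]) (dphi t)%:E = 0)%E.
  rewrite (@continuous_FTC2 _ dphi phi)//.
  - rewrite (phi0 M) ?ger0_norm ?(ltW M0)//.
    by rewrite (phi0 (- M)) ?normrN ?ger0_norm ?(ltW M0)// subee.
  - exact: continuous_subspaceT.
  - split => [t _||]; first by case: (dP t).
    + by apply: cvg_at_right_filter; exact: cphi.
    + by apply: cvg_at_left_filter; exact: cphi.
  - by move=> t _; rewrite derive1E; case: (dP t).
have ifun : lebesgue_measure.-integrable `[(- M)%R, M] (EFin \o dphi).
  apply: continuous_compact_integrable; first exact: segment_compact.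
  exact: continuous_subspaceT.
have -> : (\int[lebesgue_measure]_t ((EFin \o dphi)^\+ t) =
    \int[lebesgue_measure]_(t in `[(- M)%R, M]) ((EFin \o dphi)^\+ t))%E.
  rewrite [RHS]integral_mkcond; apply: eq_integral => t _.
  rewrite patchE; case: ifPn => // /out0 t0.
  by rewrite funeposE/= t0 maxxx.
have -> : (\int[lebesgue_measure]_t ((EFin \o dphi)^\- t) =
    \int[lebesgue_measure]_(t in `[(- M)%R, M]) ((EFin \o dphi)^\- t))%E.
  rewrite [RHS]integral_mkcond; apply: eq_integral => t _.
  rewrite patchE; case: ifPn => // /out0 t0.
  by rewrite funenegE/= t0 oppr0 maxxx.
(* Finiteness allows the negative part to be moved across the equality in the extended reals. *)
have pfin : (\int[lebesgue_measure]_(x in `[(- M)%R, M])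
    ((EFin \o dphi)^\+ x) \is a fin_num)%E.
  by apply: (integrable_pos_fin_num _ ifun); exact: measurable_itv.
have := int0; rewrite integralE => /eqP.
by rewrite sube_eq ?add0e ?fin_num_adde_defr// => /eqP.
Qed.

Lemma is_derive_exprn (f : R -> R) n (x df : R) : is_derive x 1 f df ->
  is_derive x 1 (fun y => f y ^+ n) (n%:R * f x ^+ n.-1 * df).
Proof. by move=> fd; have := is_deriveX n fd; rewrite exprfctE. Qed.

(** The exponent is at least [2], so the absolute value causes no trouble at [0]: there the slope
    function is [|z| ^+ m * z], which is continuous and vanishes. *)
Lemma is_derive_normX m (y : R) :
  is_derive y 1 (fun z : R => `|z| ^+ m.+2) (m.+2%:R * (`|y| ^+ m * y)).
Proof.
have [y0|y0|->] := ltgtP y 0.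
- have dX : is_derive y 1 (fun z : R => (- z) ^+ m.+2)
      (m.+2%:R * (`|y| ^+ m * y)).
    have := is_derive_exprn m.+2 (is_deriveN (is_derive_id y 1)).
    move/is_derive_eq; apply; rewrite /= ltr0_norm//.
    by rewrite !fctE /= exprSr; ring.
  apply: (near_eq_is_derive _ dX).
  by near=> z; rewrite ltr0_norm//; near: z; exact: lt_nbhsl.
- have dX : is_derive y 1 (fun z : R => z ^+ m.+2) (m.+2%:R * (`|y| ^+ m * y)).
    have := is_derive_exprn m.+2 (is_derive_id y 1).
    move/is_derive_eq; apply; rewrite /= gtr0_norm//.
    by rewrite exprSr; ring.
  apply: (near_eq_is_derive _ dX).
  by near=> z; rewrite gtr0_norm//; near: z; exact: lt_nbhsr.
- apply/is_derive1_caratheodory; exists (fun z => `|z| ^+ m * z); split.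
  + move=> z; rewrite normr0 expr0n/= !subr0 -mulrA -expr2.
    by rewrite -(real_normK (num_real z)) -exprD addn2.
  + apply: continuousM; last exact: cvg_id.
    apply: (@continuous_comp _ _ _ (fun z : R => `|z|) (fun z : R => z ^+ m)).
      exact: norm_continuous.
    exact: exprn_continuous.
  + by rewrite !mulr0.
Unshelve. all: by end_near. Qed.

(** Here [u] stands for [f] on a line, [t] for the moving coordinate and [c] for the sum of squares
    of the fixed ones, so [N] is the Euclidean norm along the line. As [c > 0], [N] never vanishes
    and the chain and product rules apply everywhere. *)
Lemma is_derive_flux m (c : R) (u : R -> R) (t du : R) : 0 < c ->
  is_derive t 1 u du ->
  let N s := Num.sqrt (c + s ^+ 2) in
  is_derive t 1
    (fun s => `|u s| ^+ m.+2 * (ln (N s) * (s * (N s ^+ m.+2)^-1)))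
    (m.+2%:R * (`|u t| ^+ m * u t) * du * ln (N t) * t / N t ^+ m.+2 +
     `|u t| ^+ m.+2 * ((1 - m.+2%:R * ln (N t)) * (t / N t) ^+ 2 + ln (N t))
       / N t ^+ m.+2).
Proof.
move=> c0 du' N.
have ct s : 0 < c + s ^+ 2 by rewrite ltr_wpDr// sqr_ge0.
have N0 s : 0 < N s by rewrite sqrtr_gt0.
have dS : is_derive t 1 (fun s => c + s ^+ 2) (2 * t).
  have := is_deriveD (is_derive_cst c t 1) (is_derive_exprn 2 (is_derive_id t 1)).
  by move/is_derive_eq; apply; rewrite /= expr1; ring.
have dN : is_derive t 1 N (t / N t).
  have := @is_derive1_comp _ Num.sqrt (fun s => c + s ^+ 2) t _ _
    (is_derive1_sqrt (ct t)) dS.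
  move/is_derive_eq; apply.
  by rewrite -/(N t); field; rewrite gt_eqF.
have dL : is_derive t 1 (fun s => ln (N s)) ((N t)^-1 * (t / N t)).
  exact: (@is_derive1_comp _ (@ln R) N t _ _ (is_derive1_ln (N0 t)) dN).
have dNn : is_derive t 1 (fun s => N s ^+ m.+2) (m.+2%:R * N t ^+ m.+1 * (t / N t)).
  exact: is_derive_exprn.
have dV := @is_deriveV _ (fun s => N s ^+ m.+2) t _ _
  (lt0r_neq0 (exprn_gt0 m.+2 (N0 t))) dNn.
have dU := @is_derive1_comp _ (fun y => `|y| ^+ m.+2) u t _ _
  (is_derive_normX m (u t)) du'.
have := is_deriveM dU (is_deriveM dL (is_deriveM (is_derive_id t 1) dV)).
move/is_derive_eq; apply.
rewrite /GRing.scale/= !fctE.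
have Nt : N t != 0 by rewrite gt_eqF.
rewrite !exprS; field.
by rewrite expf_neq0 Nt.
Qed.

Lemma continuous_flux_derivative m (c : R) (u du : R -> R) : 0 < c ->
  continuous u -> continuous du ->
  let N s := Num.sqrt (c + s ^+ 2) in
  continuous (fun t =>
    m.+2%:R * (`|u t| ^+ m * u t) * du t * ln (N t) * t / N t ^+ m.+2 +
    `|u t| ^+ m.+2 * ((1 - m.+2%:R * ln (N t)) * (t / N t) ^+ 2 + ln (N t))
       / N t ^+ m.+2).
Proof.
move=> c0 cu cdu N t.
have N0 : 0 < N t by rewrite sqrtr_gt0 ltr_wpDr// sqr_ge0.
have cX (g : R -> R) (l : R) k :
    g s @[s --> t] --> l -> g s ^+ k @[s --> t] --> l ^+ k.
  by move=> gl; exact: (cvg_comp _ _ gl (@exprn_continuous _ _ _)).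
have tt : s @[s --> t] --> t by exact: cvg_id.
have ut := cu t; have dut := cdu t.
have nut : `|u s| @[s --> t] --> `|u t| by exact: cvg_norm.
have Nt : N s @[s --> t] --> N t.
  have St : c + s ^+ 2 @[s --> t] --> c + t ^+ 2.
    by apply: cvgD; [exact: cvg_cst|exact: cX].
  exact: (cvg_comp _ _ St (@sqrt_continuous _ _)).
have Lt : ln (N s) @[s --> t] --> ln (N t).
  exact: (cvg_comp _ _ Nt (continuous_ln N0)).
have NVt k : (N s ^+ k)^-1 @[s --> t] --> (N t ^+ k)^-1.
  by apply: cvgV; [rewrite expf_neq0// gt_eqF|exact: cX].
have tNt : (s / N s) ^+ 2 @[s --> t] --> (t / N t) ^+ 2.
  by apply: cX; apply: cvgM => //; exact: (NVt 1%N).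
apply: cvgD; apply: cvgM; [|exact: NVt| |exact: NVt].
- apply: cvgM; [|exact: tt]; apply: cvgM; [|exact: Lt].
  apply: cvgM; [|exact: dut]; apply: cvgM; [exact: cvg_cst|].
  by apply: cvgM; [exact: cX|exact: ut].
- apply: cvgM; [exact: cX|]; apply: cvgD; [|exact: Lt].
  apply: cvgM; [|exact: tNt]; apply: cvgB; [exact: cvg_cst|].
  by apply: cvgM; [exact: cvg_cst|exact: Lt].
Qed.

End one_variable.

(** * Restriction to coordinate lines, bounded supports and null hyperplanes *)

Section coordinate_lines.
Context (R : realType) (n : nat).
Implicit Types (x : 'rV[R]_n) (f : 'rV[R]_n -> R).

Lemma ler_coord_norm x i : `|x ord0 i| <= `|x|.
Proof.
rewrite /Num.norm/= mx_normrE.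
exact: (le_bigmax _ (fun k => `|x k.1 k.2|) (ord0, i)).
Qed.

Lemma updii x i t : upd x i t ord0 i = t.
Proof. by rewrite mxE eqxx. Qed.

Lemma upd_continuous x i : continuous (upd x i).
Proof.
move=> t; apply/cvg_ballP => e e0; near=> s; split => // k j.
rewrite (ord1 k) !mxE; case: eqP => _; last exact: ballxx.
by near: s; exact: cvgr_dist_lt.
Unshelve. all: by end_near. Qed.

Lemma enorm_upd x i t :
  enorm (upd x i t) = Num.sqrt (\sum_(j < n | j != i) x ord0 j ^+ 2 + t ^+ 2).
Proof.
rewrite /enorm (bigD1 i)//= updii addrC; congr (Num.sqrt (_ + _)).
by apply: eq_bigr => j /negbTE ji; rewrite mxE ji.
Qed.

(** Moving the parameter by [h] adds [h] times the [i]-th basis vector, so the two difference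
    quotients are the same function of [h]. *)
Lemma is_derive_upd f x i t : differentiable f (upd x i t) ->
  is_derive t 1 (fun s => f (upd x i s)) (gradient f (upd x i t) ord0 i).
Proof.
move=> df; rewrite mxE.
have E : (fun h : R => h^-1 *: (((fun s => f (upd x i s)) \o shift t) (h *: 1) -
      f (upd x i t))) =
    (fun h : R => h^-1 *: ((f \o shift (upd x i t)) (h *: delta_mx ord0 i) -
      f (upd x i t))).
  apply/funext => h /=; congr (_ *: (f _ - _)); apply/rowP => j.
  rewrite !mxE eqxx/=; case: eqP => _; first by rewrite /GRing.scale/= mulr1.
  by rewrite mulr0 add0r.
have := @diff_derivable _ _ _ _ _ (delta_mx ord0 i) df.
by split; rewrite /derivable /derive E.
Qed.

Lemma compactly_supported_bounded f : compactly_supported f ->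
  exists2 M : R, 0 < M & forall x, f x != 0 -> forall i, `|x ord0 i| < M.
Proof.
move=> /compact_bounded[M [_ bM]].
(* Any number strictly above [M] bounds the support; [|M| + 1] is one, and one unit more makes the
   inequality strict. *)
exists (`|M| + 2); first by rewrite ltr_wpDl.
move=> x fx i; apply: (le_lt_trans (ler_coord_norm x i)).
apply: (@le_lt_trans _ _ (`|M| + 1)); last by rewrite ltrD2l ltr1n.
apply: bM; last exact: subset_closure.
by rewrite (le_lt_trans (ler_norm _))// ltrDl.
Qed.

(** The hyperplane is a box with side [{0}] in direction [k] and full lines elsewhere; the product
    of the side measures is [0] even though other factors are infinite, since [0] times [+oo] is
    [0]. *)
Lemma lebesgue_measure_rV_hyperplane (k : 'I_n) :
  measurable [set x : 'rV[R]_n | x ord0 k = 0] /\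
  lebesgue_measure_rV R n [set x : 'rV[R]_n | x ord0 k = 0] = 0%E.
Proof.
pose A j : set R := if j == k then [set 0] else setT.
have mA j : measurable (A j) by rewrite /A; case: ifP.
have -> : [set x : 'rV[R]_n | x ord0 k = 0] = [set x | forall j, A j (x ord0 j)].
  apply/seteqP; split => x /= => [xk j|/(_ k)]; last by rewrite /A eqxx.
  by rewrite /A; case: eqP => // ->.
split; first exact: measurable_box.
by rewrite lebesgue_measure_rV_box// (bigD1 k)//= /A eqxx lebesgue_measure_set1 mul0e.
Qed.

End coordinate_lines.

(** * The terms of the divergence and their integrals *)

Section flux.
Context (R : realType) (m : nat) (f : 'rV[R]_m.+2 -> R) (hf : C01 f).
Local Notation n := m.+2.
Local Notation leb := (lebesgue_measure_rV R n).

(* The i-th term of the divergence of |f|^n log|x| x / |x|^n; it is 0 at x = 0,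
   because of the division by [enorm x ^+ n]. *)
Definition dflux (i : 'I_n) (x : 'rV[R]_n) : R :=
  n%:R * (`|f x| ^+ m * f x) * gradient f x ord0 i * ln (enorm x) * x ord0 i
    / enorm x ^+ n +
  `|f x| ^+ n * ((1 - n%:R * ln (enorm x)) * (x ord0 i / enorm x) ^+ 2
    + ln (enorm x)) / enorm x ^+ n.

Lemma C01_continuous : continuous f.
Proof. by move=> x; apply: differentiable_continuous; case: hf => -[+ _ _]; exact. Qed.

Lemma gradient_coord_continuous i : continuous (fun x => gradient f x ord0 i).
Proof.
case: hf => -[_ cg] _ x.
exact: (cvg_comp _ _ (cg x) (@coord_continuous _ _ _ _ _ _)).
Qed.

Lemma C01_measurable : measurable_fun setT f.
Proof. by apply: continuous_measurable_rV; exact: C01_continuous. Qed.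

Lemma measurable_normX k : measurable_fun setT (fun x => `|f x| ^+ k).
Proof.
by apply: measurable_funX; apply: measurableT_comp => //; exact: C01_measurable.
Qed.

Lemma integral_dflux_line i k (x : 'rV[R]_n) : k != i -> x ord0 k != 0 ->
  (\int[lebesgue_measure]_t ((EFin \o dflux i)^\+ (upd x i t)) =
   \int[lebesgue_measure]_t ((EFin \o dflux i)^\- (upd x i t)))%E.
Proof.
move=> ki xk.
(* This is the squared distance from the line to the origin; the nonzero coordinate [k] makes it
   positive. *)
pose c := \sum_(j < n | j != i) x ord0 j ^+ 2.
have c0 : 0 < c.
  rewrite /c (bigD1 k)//= ltr_wpDr ?sumr_ge0// => [j _|]; first exact: sqr_ge0.
  by rewrite exprn_even_gt0.
have [M M0 fM] := compactly_supported_bounded (proj2 hf).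
pose u s := f (upd x i s).
pose du s := gradient f (upd x i s) ord0 i.
have cu : continuous u.
  by move=> t; exact: (cvg_comp _ _ (@upd_continuous _ _ x i t) (@C01_continuous _)).
have cdu : continuous du.
  move=> t.
  exact: (cvg_comp _ _ (@upd_continuous _ _ x i t) (@gradient_coord_continuous i _)).
have du' (t : R) : is_derive t 1 u (du t).
  by apply: is_derive_upd; case: hf => -[].
have fluxE : dflux i \o upd x i = (fun t =>
    n%:R * (`|u t| ^+ m * u t) * du t * ln (Num.sqrt (c + t ^+ 2)) * t
      / Num.sqrt (c + t ^+ 2) ^+ n +
    `|u t| ^+ n * ((1 - n%:R * ln (Num.sqrt (c + t ^+ 2)))
      * (t / Num.sqrt (c + t ^+ 2)) ^+ 2 + ln (Num.sqrt (c + t ^+ 2)))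
      / Num.sqrt (c + t ^+ 2) ^+ n).
  by apply/funext => t /=; rewrite /dflux updii !enorm_upd.
have := integral_derive_compact M0 (fun t => @is_derive_flux _ m c _ _ _ c0 (du' t))
  (@continuous_flux_derivative _ m c _ _ c0 cu cdu).
rewrite -fluxE => H.
rewrite (_ : (fun t => (EFin \o dflux i)^\+ (upd x i t))%E =
    (EFin \o (dflux i \o upd x i))^\+%E); last first.
  by apply/funext => t; rewrite !funeposE.
rewrite (_ : (fun t => (EFin \o dflux i)^\- (upd x i t))%E =
    (EFin \o (dflux i \o upd x i))^\-%E); last first.
  by apply/funext => t; rewrite !funenegE.
apply: H => s Ms; rewrite /u.
suff -> : f (upd x i s) = 0 by rewrite normr0 expr0n mul0r.
apply/eqP; apply: contraT => /fM/(_ i).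
by rewrite updii ltNge Ms.
Qed.

Lemma measurable_dflux i : measurable_fun setT (dflux i).
Proof.
have mf := C01_measurable.
have mg : measurable_fun setT (fun x => gradient f x ord0 i).
  by apply: continuous_measurable_rV; exact: gradient_coord_continuous.
have mN := @measurable_enorm R n.
have mc := @measurable_coord _ R n i.
have mL : measurable_fun setT (fun x : 'rV[R]_n => ln (enorm x)).
  by apply: measurableT_comp mN; exact: measurable_ln.
have ma := measurable_normX.
have mV := @measurable_enormXV R n.
have mxN : measurable_fun setT (fun x : 'rV[R]_n => x ord0 i / enorm x).
  by apply: measurable_funM mc _; exact: (mV 1%N).
apply: measurable_funD; apply: measurable_funM => //; apply: measurable_funM => //.
  do 3 apply: measurable_funM => //.
  exact: measurable_funM.
apply: measurable_funD => //; apply: measurable_funM; last exact: measurable_funX.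
by apply: measurable_funB => //; exact: measurable_funM.
Qed.

(** The lines give this without knowing that [dflux i] is integrable; once it is, both sides are
    finite and the integral is [0]. *)
Lemma integral_dflux_posneg i :
  (\int[leb]_x ((EFin \o dflux i)^\+ x) = \int[leb]_x ((EFin \o dflux i)^\- x))%E.
Proof.
(* A second coordinate exists because the dimension is at least [2]. *)
have [k ki] : exists k : 'I_n, k != i.
  exists (if i == ord0 then ord_max else ord0).
  by case: (eqVneq i ord0) => [->|]; rewrite // eq_sym.
have [mH H0] := lebesgue_measure_rV_hyperplane R k.
have mD : measurable_fun setT (EFin \o dflux i).
  by apply/measurable_EFinP; exact: measurable_dflux.
have mp := measurable_funepos mD; have mn := measurable_funeneg mD.
(* Off the null hyperplane x_k = 0, no line in direction i meets the origin. *)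
rewrite (@ge0_negligible_integral _ _ _ leb setT _ _ mH)//.
rewrite [RHS](@ge0_negligible_integral _ _ _ leb setT _ _ mH)//.
rewrite integral_mkcond [RHS]integral_mkcond.
have mS : measurable ([set: 'rV[R]_n] `\` [set x : 'rV[R]_n | x ord0 k = 0]).
  exact: measurableD.
apply: (@eq_integral_lines R n i).
- by apply/(measurable_restrictT _ mS); exact: measurable_funTS.
- by apply/(measurable_restrictT _ mS); exact: measurable_funTS.
- by move=> x; rewrite patchE; case: ifP => // _; exact: funepos_ge0.
- by move=> x; rewrite patchE; case: ifP => // _; exact: funeneg_ge0.
move=> x.
have updk t : upd x i t ord0 k = x ord0 k by rewrite mxE (negbTE ki).
(* Since [k] differs from [i], a line lies either inside the hyperplane, where both restricted
   integrands vanish, or wholly outside it. *)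
have [xk|xk] := eqVneq (x ord0 k) 0.
  transitivity (\int[@lebesgue_measure R]_t (cst 0 t))%E; last apply/esym;
  by apply: eq_integral => t _; rewrite patchE memNset//= updk => -[].
transitivity (\int[@lebesgue_measure R]_t (EFin \o dflux i)^\+ (upd x i t))%E.
  apply: eq_integral => t _; rewrite patchE mem_set//=; split => //.
  by rewrite updk; exact/eqP.
rewrite (integral_dflux_line ki xk); apply: eq_integral => t _.
by rewrite patchE mem_set//=; split => //; rewrite updk; exact/eqP.
Qed.

End flux.

(** * Cauchy-Schwarz, Young and bounds for the logarithmic weight *)

Section pointwise_bounds.
Context (R : realType).

(** With [A], [B], [C] as in the proof, the sum of the squares of [B * x i - C * y i] is
    [B * (A * B - C ^+ 2)]; it is nonnegative, and [B] can be divided out unless [y] is zero. *)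
Lemma sqr_sum_mul n (x y : 'I_n -> R) :
  (\sum_i x i * y i) ^+ 2 <= (\sum_i x i ^+ 2) * (\sum_i y i ^+ 2).
Proof.
set A := \sum_i x i ^+ 2; set B := \sum_i y i ^+ 2; set C := \sum_i _.
have B0 : 0 <= B by apply: sumr_ge0 => i _; exact: sqr_ge0.
have [BE|BN] := eqVneq B 0.
  have y0 i : y i = 0.
    move/eqP: BE; rewrite psumr_eq0 => [/allP/(_ i)|j _]; last exact: sqr_ge0.
    by rewrite mem_index_enum sqrf_eq0 => /(_ isT)/eqP.
  by rewrite /C big1 ?expr0n ?BE ?mulr0// => i _; rewrite y0 mulr0.
have Bp : 0 < B by rewrite lt_def BN.
have : 0 <= \sum_i (B * x i - C * y i) ^+ 2.
  by apply: sumr_ge0 => i _; exact: sqr_ge0.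
have -> : \sum_i (B * x i - C * y i) ^+ 2 = B * (A * B - C ^+ 2).
  have E i : (B * x i - C * y i) ^+ 2 =
      B ^+ 2 * x i ^+ 2 + (- (2 * B * C)) * (x i * y i) + C ^+ 2 * y i ^+ 2.
    by move: B C (x i) (y i) {B0 BN Bp} => b c u v; ring.
  under eq_bigr do rewrite E.
  rewrite !big_split/= -!mulr_sumr -/A -/B -/C.
  by move: A B C {B0 BN Bp E} => a b c; ring.
by rewrite pmulr_rge0// subr_ge0.
Qed.

Lemma enorm_ge0 n (x : 'rV[R]_n) : 0 <= enorm x.
Proof. exact: sqrtr_ge0. Qed.

Lemma enorm_sqr n (x : 'rV[R]_n) : enorm x ^+ 2 = \sum_i x ord0 i ^+ 2.
Proof. by rewrite sqr_sqrtr// sumr_ge0// => i _; exact: sqr_ge0. Qed.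

Lemma enorm_cauchy_schwarz n (x y : 'rV[R]_n) :
  `|\sum_i x ord0 i * y ord0 i| <= enorm x * enorm y.
Proof.
rewrite -(ler_pXn2r (_ : 0 < 2)%N) ?nnegrE ?mulr_ge0 ?enorm_ge0//.
by rewrite real_normK ?num_real// exprMn !enorm_sqr; exact: sqr_sum_mul.
Qed.

Lemma ler_coord_enorm n (x : 'rV[R]_n) i : `|x ord0 i| <= enorm x.
Proof.
rewrite -(ler_pXn2r (_ : 0 < 2)%N) ?nnegrE ?enorm_ge0// real_normK ?num_real//.
by rewrite enorm_sqr (bigD1 i)//= lerDl sumr_ge0// => j _; exact: sqr_ge0.
Qed.

Lemma normr_ln_div1 (a : R) : 0 <= a -> `|ln (1 / a)| = `|ln a|.
Proof.
rewrite le_eqVlt => /predU1P[<-|a0]; first by rewrite invr0 mulr0.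
by rewrite div1r lnV ?posrE// normrN.
Qed.

Section weight.
Variable m : nat.
Local Notation n := m.+2.
(** The Young conjugate of the exponent [n]. *)
Let p : R := n%:R / (n%:R - 1).

Let n1E : n%:R - 1 = m.+1%:R :> R.
Proof. by rewrite -natr1 addrK. Qed.

Let p_gt0 : 0 < p.
Proof. by rewrite /p n1E divr_gt0. Qed.

Let p_ge1 : 1 <= p.
Proof. by rewrite /p n1E ler_pdivlMr ?ltr0n// mul1r ler_nat. Qed.

(** Young's inequality for [G] and [b = l * (a / N) ^+ (n - 1)], multiplied by [n]. Since
    [(n - 1) * p = n], the power [b] to the [p] is the weighted term, and its coefficient is
    [n / p = n - 1]. *)
Lemma young_flux (a N l G : R) : 0 <= a -> 0 < N -> 0 <= l -> 0 <= G ->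
  n%:R * (a ^+ m.+1 * l * G / N ^+ m.+1) <=
  G ^+ n + (n%:R - 1) * (l `^ p / N ^+ n * a ^+ n).
Proof.
move=> a0 N0 l0 G0.
have aN0 : 0 <= a / N by rewrite divr_ge0// ltW.
pose b := l * (a / N) ^+ m.+1.
have b0 : 0 <= b by rewrite mulr_ge0// exprn_ge0.
have bp : b `^ p = l `^ p / N ^+ n * a ^+ n.
  rewrite powRM ?exprn_ge0// -powR_mulrn// -powRrM.
  rewrite (_ : m.+1%:R * p = n%:R); last first.
    by rewrite /p n1E mulrC divfK// pnatr_eq0.
  by rewrite powR_mulrn// expr_div_n; ring.
have n0 : 0 < n%:R :> R by rewrite ltr0n.
have conj : n%:R^-1 + p^-1 = 1 :> R.
  rewrite /p n1E invf_div -mulrC -{1}[n%:R^-1]mul1r mulrC -mulrDl.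
  by rewrite nat1r divff// pnatr_eq0.
have := conjugate_powR G0 b0 n0 p_gt0 conj.
rewrite bp powR_mulrn// => H.
have := ler_wpM2l (ltW n0) H.
rewrite [X in X <= _](_ : _ = n%:R * (a ^+ m.+1 * l * G / N ^+ m.+1)); last first.
  by rewrite /b expr_div_n; ring.
move=> /le_trans; apply; rewrite mulrDr mulrCA divff ?gt_eqF// mulr1 lerD2l.
rewrite le_eqVlt; apply/orP; left; apply/eqP.
rewrite mulrCA mulrC; congr (_ * _).
by rewrite /p invf_div mulrC divfK// gt_eqF.
Qed.

(** The [1] covers [l <= 1]; beyond that, [p >= 1] makes the power dominate. *)
Lemma normr_le_powR (l : R) : 0 <= l -> l <= 1 + l `^ p.
Proof.
move=> l0; have [l1|l1] := leP l 1; first by rewrite ler_wpDr// powR_ge0.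
rewrite ler_wpDl// -{1}(powRr1 l0); apply: ler_powR => //; exact: ltW.
Qed.

(* Inside the ball of radius [1/e] the logarithmic weight is at least [1]. *)
Lemma hardy_weight_le (a N : R) : 0 <= a -> 0 <= N ->
  a ^+ n / N ^+ n <= `|ln N| `^ p / N ^+ n * a ^+ n + expR 1 ^+ n * a ^+ n.
Proof.
move=> a0; rewrite le_eqVlt => /predU1P[<-|N0].
  (* At [N = 0] the quotients are [0], because the inverse of [0] is [0]. *)
  by rewrite expr0n invr0 mulr0 mulr0 mul0r add0r mulr_ge0// exprn_ge0// expR_ge0.
have an : 0 <= a ^+ n by rewrite exprn_ge0.
have Nn : 0 < N ^+ n by rewrite exprn_gt0.
have [Ne|Ne] := leP N (expR (-1)).
  apply: ler_wpDr; first by rewrite mulr_ge0// exprn_ge0// expR_ge0.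
  rewrite [leRHS]mulrAC ler_wpM2r ?invr_ge0 ?(ltW Nn)// ler_peMl//.
  have L1 : ln N <= -1 by rewrite -[leRHS]expRK ler_ln ?posrE ?expR_gt0.
  rewrite -(powRr0 `|ln N|); apply: ler_powR; last exact: (ltW p_gt0).
  by have : -1 <= 0 :> R by []; rewrite ler0_norm; lra.
(* Outside that ball [1 / N] is below [expR 1], so the unweighted term alone suffices. *)
apply: ler_wpDl.
  by rewrite mulr_ge0// mulr_ge0 ?powR_ge0// invr_ge0 (ltW Nn).
rewrite mulrC ler_wpM2r//.
rewrite -exprVn lerXn2r ?nnegrE ?invr_ge0 ?expR_ge0 ?(ltW N0)//.
by rewrite -[leRHS]invrK -expRN lef_pV2 ?posrE ?expR_gt0// ltW.
Qed.

End weight.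
End pointwise_bounds.

(** * Pointwise comparison of the divergence with the integrands of the theorem *)

Section hardy.
Context (R : realType) (m : nat) (f : 'rV[R]_m.+2 -> R) (hf : C01 f).
Local Notation n := m.+2.
Local Notation leb := (lebesgue_measure_rV R n).
Local Notation p := (n%:R / (n%:R - 1) : R).

Definition log_weight (x : 'rV[R]_n) : R :=
  `|ln (1 / enorm x)| `^ p / enorm x ^+ n * `|f x| ^+ n.

Local Notation W := log_weight.

Lemma log_weightE x : W x = `|ln (enorm x)| `^ p / enorm x ^+ n * `|f x| ^+ n.
Proof. by rewrite /log_weight normr_ln_div1// enorm_ge0. Qed.

Lemma log_weight_ge0 x : 0 <= W x.
Proof.
rewrite /log_weight mulr_ge0 ?exprn_ge0// mulr_ge0 ?powR_ge0// invr_ge0.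
by rewrite exprn_ge0// enorm_ge0.
Qed.

Let G_ge0 x : 0 <= enorm (gradient f x) ^+ n.
Proof. by rewrite exprn_ge0// enorm_ge0. Qed.

Let coef_ge0 (a l N : R) : 0 <= a -> 0 <= l -> 0 <= N ->
  0 <= n%:R * a ^+ m.+1 * l / N ^+ n.
Proof.
move=> a0 l0 N0; rewrite divr_ge0 ?exprn_ge0// mulr_ge0//.
by rewrite mulr_ge0 ?ler0n// exprn_ge0.
Qed.

(** The squares of [x_i / |x|] add up to [1], so the second terms sum to
    [(1 - n * ln |x|) + n * ln |x| = 1]: the logarithms cancel, as [x / |x|^n] is divergence free.
    At the origin both sides are [0] by the convention on inverses. *)
Lemma sum_dflux x : \sum_i dflux f i x =
  n%:R * (`|f x| ^+ m * f x) * (\sum_i x ord0 i * gradient f x ord0 i)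
    * ln (enorm x) / enorm x ^+ n + `|f x| ^+ n / enorm x ^+ n.
Proof.
have := enorm_ge0 x; rewrite le_eqVlt => /predU1P[N0|N0].
  rewrite -N0 expr0n invr0 !mulr0 addr0 big1// => i _.
  by rewrite /dflux -N0 expr0n invr0 !mulr0 addr0.
have S1 : \sum_i (x ord0 i / enorm x) ^+ 2 = 1.
  under eq_bigr do rewrite expr_div_n.
  by rewrite -mulr_suml -enorm_sqr divff// expf_neq0// gt_eqF.
rewrite /dflux big_split/=; congr (_ + _).
  rewrite mulr_sumr !mulr_suml; apply: eq_bigr => i _; ring.
rewrite -mulr_suml -mulr_sumr big_split/= -mulr_sumr S1.
rewrite sumr_const card_ord -mulr_natr.
by congr (_ / _); ring.
Qed.

(** Subtracting the divergence cancels the singular term and leaves the one with [x . grad f], to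
    which Cauchy-Schwarz and then [young_flux] apply. *)
Lemma hardy_pointwise x : `|f x| ^+ n / enorm x ^+ n - \sum_i dflux f i x <=
  enorm (gradient f x) ^+ n + (n%:R - 1) * W x.
Proof.
rewrite sum_dflux opprD addrCA subrr addr0 log_weightE.
have := enorm_ge0 x; rewrite le_eqVlt => /predU1P[N0|N0].
  by rewrite -N0 expr0n invr0 !(mulr0, mul0r) oppr0 addr0.
apply: le_trans (young_flux m (normr_ge0 (f x)) N0 (normr_ge0 (ln (enorm x)))
  (enorm_ge0 (gradient f x))).
apply: (le_trans (ler_norm _)); rewrite normrN !normrM !normrX !normr_id.
rewrite normfV normrX (ger0_norm (enorm_ge0 x)) normr_nat.
have CS := enorm_cauchy_schwarz x (gradient f x).
set s := `|\sum_i _| in CS *; set a := `|f x|; set l := `|ln _|.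
set N := enorm x in CS N0 *; set G := enorm _ in CS *.
have -> : n%:R * (a ^+ m.+1 * l * G / N ^+ m.+1) =
    n%:R * a ^+ m.+1 * l / N ^+ n * (N * G).
  rewrite (exprS N m.+1); field.
  by rewrite expf_neq0 ?gt_eqF.
have -> : n%:R * (a ^+ m * a) * s * l / N ^+ n = n%:R * a ^+ m.+1 * l / N ^+ n * s.
  by rewrite (exprS a m); ring.
by rewrite ler_wpM2l// coef_ge0// ?normr_ge0// ltW.
Qed.

(** An integrable majorant. The first two summands bound the gradient term by [young_flux]. The
    other term is at most [|f|^n / |x|^n] times [(n + 2) + (n + 1) * |ln |x||^p]; applying
    [hardy_weight_le] to the part with [n + 2] yields the coefficient
    [(n + 2) + (n + 1) = 2 * n + 3] of [W]. *)
Lemma dflux_le i x : `|dflux f i x| <=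
  enorm (gradient f x) ^+ n + (n%:R - 1) * W x
  + ((n + n.+3)%:R * W x + (n.+2)%:R * expR 1 ^+ n * `|f x| ^+ n).
Proof.
have := enorm_ge0 x; rewrite le_eqVlt => /predU1P[N0|N0].
  rewrite [X in `|X|](_ : _ = 0).
    rewrite normr0; apply: addr_ge0; apply: addr_ge0 => //.
    - by rewrite mulr_ge0 ?log_weight_ge0// subr_ge0 ler1n.
    - by rewrite mulr_ge0// log_weight_ge0.
  by rewrite /dflux -N0 expr0n invr0 !mulr0 addr0.
rewrite /dflux log_weightE (le_trans (ler_normD _ _))// lerD//.
  apply: le_trans (young_flux m (normr_ge0 (f x)) N0 (normr_ge0 (ln (enorm x)))
    (enorm_ge0 (gradient f x))).
  rewrite !normrM !normrX !normr_id normfV normrX (ger0_norm (enorm_ge0 x)).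
  rewrite normr_nat.
  have gG := ler_coord_enorm (gradient f x) i.
  have xN := ler_coord_enorm x i.
  set g := `|gradient f x _ _| in gG *; set y := `|x _ _| in xN *.
  set a := `|f x|; set l := `|ln _|.
  set N := enorm x in xN N0 *; set G := enorm _ in gG *.
  have -> : n%:R * (a ^+ m.+1 * l * G / N ^+ m.+1) =
      n%:R * a ^+ m.+1 * l / N ^+ n * (N * G).
    rewrite (exprS N m.+1); field.
    by rewrite expf_neq0 ?gt_eqF.
  have -> : n%:R * (a ^+ m * a) * g * l * y / N ^+ n =
      n%:R * a ^+ m.+1 * l / N ^+ n * (y * g).
    by rewrite (exprS a m); ring.
  rewrite ler_wpM2l ?ler_pM ?normr_ge0//.
  by rewrite coef_ge0 ?normr_ge0// ltW.
rewrite 2!normrM normfV !normrX normr_id (ger0_norm (enorm_ge0 x)).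
have xN := ler_coord_enorm x i.
have hW := hardy_weight_le m (normr_ge0 (f x)) (enorm_ge0 x).
have hl := normr_le_powR m (normr_ge0 (ln (enorm x))).
set y := x _ _ in xN *; set L := ln _ in hW hl *.
set a := `|f x| in hW *; set N := enorm x in xN hW N0 *.
(* A coordinate is at most the norm in absolute value, so [(y / N) ^+ 2 <= 1]. *)
have t1 : `|(1 - n%:R * L) * (y / N) ^+ 2 + L| <= 1 + n.+1%:R * `|L|.
  apply: (le_trans (ler_normD _ _)).
  rewrite (_ : n.+1%:R * `|L| = n%:R * `|L| + `|L|); last first.
    by rewrite -[n.+1%:R]natr1 mulrDl mul1r.
  rewrite addrA lerD2r normrM.
  rewrite (@le_trans _ _ `|1 - n%:R * L|)//.
    rewrite ler_piMr// normrX exprn_ile1// normrM normfV (gtr0_norm N0).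
    by rewrite ler_pdivrMr// mul1r.
  by rewrite (le_trans (ler_normB _ _))// normr1 normrM normr_nat.
have t2 : 1 + n.+1%:R * `|L| <= n.+2%:R + n.+1%:R * `|L| `^ p.
  rewrite -[n.+2%:R]natr1.
  have := ler_wpM2l (ler0n R n.+1) hl.
  by rewrite mulrDr mulr1 => H; lra.
set q := `|L| `^ p in hW t2 *.
have aN0 : 0 <= a ^+ n / N ^+ n.
  by rewrite divr_ge0 ?exprn_ge0 ?normr_ge0// ltW.
rewrite mulrAC; apply: (le_trans (ler_wpM2l aN0 (le_trans t1 t2))).
have := ler_wpM2l (ler0n R n.+2) hW.
rewrite -!natr1 natrD -!natr1 => H.
by move: (a ^+ n) (N ^+ n)^-1 (expR 1 ^+ n) (m%:R) H {aN0 t1 t2 hW} => A V E k; nra.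
Qed.

End hardy.

(** * Integrability, and integration of the pointwise inequality *)

Section hardy_integral.
Context (R : realType) (m : nat) (f : 'rV[R]_m.+2 -> R) (hf : C01 f).
Local Notation n := m.+2.
Local Notation leb := (lebesgue_measure_rV R n).
Local Notation W := (log_weight f).
Local Notation G := (fun x => enorm (gradient f x) ^+ n).
Local Notation A := (fun x => `|f x| ^+ n).
Local Open Scope ereal_scope.

Lemma measurable_gradientX : measurable_fun setT G.
Proof.
apply: measurable_funX.
apply: (measurableT_comp (continuous_measurable_fun (@sqrt_continuous R))).
apply: measurable_sum => i; apply: measurable_funX.
exact: (continuous_measurable_rV (@gradient_coord_continuous _ _ _ hf i)).
Qed.

Lemma measurable_log_weight : measurable_fun setT W.
Proof.
rewrite (_ : W = fun x => (`|ln (enorm x)| `^ (n%:R / (n%:R - 1)) *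
    (enorm x ^+ n)^-1 * `|f x| ^+ n)%R); last first.
  by apply/funext => x; rewrite log_weightE.
apply: measurable_funM; last exact: measurable_normX.
apply: measurable_funM; last exact: measurable_enormXV.
apply: (measurableT_comp (measurable_powR _)); apply: measurableT_comp => //.
by apply: (measurableT_comp (@measurable_ln R)); exact: measurable_enorm.
Qed.

(** [f] is bounded, being continuous with compact support, and vanishes outside a cube of finite
    measure. *)
Lemma integrable_normX : leb.-integrable setT (EFin \o A).
Proof.
have [M M0 fM] := compactly_supported_bounded (proj2 hf).
pose Q := [set v : 'rV[R]_n | forall i, v ord0 i \in `[(- M)%R, M]].
have mQ : measurable Q.
  exact: (@measurable_box R n (fun=> `[(- M)%R, M]%classic)).
have [B fB] : exists B, forall x, (`|f x| <= B)%R.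
  have : compact (f @` closure [set x | (f x != 0)%R]).
    apply: continuous_compact; last exact: (proj2 hf).
    by apply: continuous_subspaceT; exact: C01_continuous.
  move=> /compact_bounded[B [_ bB]]; exists (`|B| + 1)%R => x.
  have [->|fx] := eqVneq (f x) 0%R; first by rewrite normr0 addr_ge0.
  apply: bB; first by rewrite (le_lt_trans (ler_norm _))// ltrDl.
  by exists x => //; exact: subset_closure.
have iA : leb.-integrable Q (EFin \o A).
  apply: measurable_bounded_integrable => //.
  - exact: lebesgue_measure_rV_cube_lty.
  - by apply: measurable_funTS; exact: measurable_normX.
  - exists (B ^+ n)%R; split; first exact: num_real.
    move=> y By x _ /=; rewrite normrX normr_id (le_trans _ (ltW By))//.
    by rewrite lerXn2r ?nnegrE// (le_trans _ (fB x)).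
have := (integrable_mkcond _ mQ).1 iA; congr (integrable _ _ _).
apply/funext => x; rewrite patchE; case: ifPn => //= xQ.
suff -> : f x = 0%R by rewrite normr0 expr0n.
apply/eqP; apply: contraNT xQ => fx; rewrite inE => i /=.
by rewrite in_itv/= -ler_norml ltW// fM.
Qed.

Lemma integrable_ge0 (g : 'rV[R]_n -> R) : measurable_fun setT g ->
  (forall x, 0 <= g x)%R -> \int[leb]_x (g x)%:E != +oo ->
  leb.-integrable setT (EFin \o g).
Proof.
move=> mg g0 goo; apply/integrableP; split; first exact/measurable_EFinP.
rewrite (eq_integral (fun x => (g x)%:E)) ?ltey// => x _.
by rewrite /= ger0_norm.
Qed.

Lemma integrable_dflux i : leb.-integrable setT (EFin \o G) ->
  leb.-integrable setT (EFin \o W) ->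
  leb.-integrable setT (EFin \o dflux f i).
Proof.
move=> iG iW; have iA := integrable_normX.
pose b x := (G x + (n%:R - 1) * W x +
  ((n + n.+3)%:R * W x + (n.+2)%:R * expR 1 ^+ n * `|f x| ^+ n))%R.
apply: (@le_integrable _ _ _ leb setT _ _ (EFin \o b)) => //.
- by apply/measurable_EFinP; exact: measurable_dflux.
- move=> x _ /=; rewrite lee_fin (le_trans (dflux_le f i x))//.
  exact: ler_norm.
rewrite (_ : EFin \o b = (EFin \o G \+ (fun x => (n%:R - 1)%:E * (W x)%:E))
  \+ ((fun x => (n + n.+3)%:R%:E * (W x)%:E) \+
  (fun x => ((n.+2)%:R * expR 1 ^+ n)%:E * (A x)%:E))).
  by do 2 apply: integrableD => //; exact: integrableZl.
by apply/funext => x /=.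
Qed.

Lemma integral_dflux i : leb.-integrable setT (EFin \o dflux f i) ->
  \int[leb]_x (dflux f i x)%:E = 0.
Proof.
move=> id; rewrite integralE.
have := integral_dflux_posneg hf i; rewrite /comp => ->.
by rewrite subee//; exact: (integrable_neg_fin_num _ id).
Qed.

Lemma hardy_log_inequality :
  \int[leb]_x (`|f x| ^+ n / enorm x ^+ n)%:E <=
  \int[leb]_x (G x)%:E + (n%:R - 1)%:E * \int[leb]_x (W x)%:E.
Proof.
have n1 : (0 < n%:R - 1 :> R)%R by rewrite subr_gt0 ltr1n.
have G0 x : (0 <= G x)%R by rewrite exprn_ge0// enorm_ge0.
have neqNy (a : \bar R) : 0 <= a -> a != -oo by case: a.
(* If either integral on the right is [+oo], so is the sum: the other one is nonnegative, hence not
   [-oo]. *)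
have [WT|WT] := eqVneq (\int[leb]_x (W x)%:E) +oo.
  rewrite WT gt0_muley ?lte_fin// addey ?leey// neqNy//.
  by apply: integral_ge0 => x _; rewrite lee_fin.
have [GT|GT] := eqVneq (\int[leb]_x (G x)%:E) +oo.
  rewrite GT addye ?leey// neqNy//.
  apply: mule_ge0; first by rewrite lee_fin ltW.
  by apply: integral_ge0 => x _; rewrite lee_fin log_weight_ge0.
have iW := integrable_ge0 measurable_log_weight (log_weight_ge0 f) WT.
have iG := integrable_ge0 measurable_gradientX G0 GT.
have iA := integrable_normX.
have iD i := integrable_dflux i iG iW.
pose H x := (`|f x| ^+ n / enorm x ^+ n)%R.
have mH : measurable_fun setT H.
  by apply: measurable_funM; [exact: measurable_normX|exact: measurable_enormXV].
(* The left integrand is dominated through [hardy_weight_le]; its integrability is what allows the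
   divergence to be subtracted under the integral. *)
have iH : leb.-integrable setT (EFin \o H).
  apply: (@le_integrable _ _ _ leb setT _ _
      ((EFin \o W) \+ (fun x => (expR 1 ^+ n)%:E * (A x)%:E))) => //.
  - exact/measurable_EFinP.
  - move=> x _ /=; rewrite lee_fin ger0_norm.
      rewrite (le_trans _ (ler_norm _))// log_weightE.
      by apply: hardy_weight_le => //; exact: enorm_ge0.
    by rewrite divr_ge0 ?exprn_ge0// enorm_ge0.
  - by apply: integrableD => //; exact: integrableZl.
have iS : leb.-integrable setT (fun x => \sum_i (dflux f i x)%:E).
  by apply: (integrable_sum measurableT) => i _; exact: iD.
have S0 : \int[leb]_x (\sum_i (dflux f i x)%:E) = 0.
  rewrite (integral_sum measurableT iD) big1// => i _.
  by apply: integral_dflux; exact: iD.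
(* The vanishing integral of the divergence is subtracted on the left, so that one integral on each
   side remains and [hardy_pointwise] compares the integrands. *)
rewrite -[leLHS]sube0 -S0 -integralB// -integralZl// -integralD//; last first.
  exact: integrableZl.
apply: le_integral => //.
- exact: integrableB.
- by apply: integrableD => //; exact: integrableZl.
move=> x _; rewrite sumEFin -EFinB -EFinM -EFinD lee_fin.
exact: hardy_pointwise.
Qed.

End hardy_integral.

Theorem mainTheorem6 (R : realType) (n : nat) (hn : (2 <= n)%N)
    (f : 'rV[R]_n -> R) (hf : C01 f) :
  (\int[lebesgue_measure_rV R n]_x (`|f x| ^+ n / enorm x ^+ n)%:E
   <= \int[lebesgue_measure_rV R n]_x (enorm (gradient f x) ^+ n)%:E
      + (n%:R - 1)%:E *
        \int[lebesgue_measure_rV R n]_x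
          (`|ln (1 / enorm x)| `^ (n%:R / (n%:R - 1)) / enorm x ^+ n
           * `|f x| ^+ n)%:E)%E.
Proof.
case: n hn f hf => [|[|m]]// _ f hf.
exact: hardy_log_inequality.
Qed.
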